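(* There exist a separable Banach space $X$, a $C_0$-semigroup $(T(t))_{t\ge 0}$ on $X$ and a reference trajectory $u_{\mathrm{ref}}\in X$ (i.e. $T(t)u_{\mathrm{ref}}=u_{\mathrm{ref}}$ for all $t\ge 0$) such that $(T(t))_{t\ge 0}$ is chaotic relative to $u_{\mathrm{ref}}$ but is not Devaney chaotic.
   Context: The trajectory of $u_0\in X$ is relatively chaotic with respect to $u_{\mathrm{ref}}$ if $\liminf_{t\to\infty}\|T(t)u_0-T(t)u_{\mathrm{ref}}\|=0$ and $\limsup_{t\to\infty}\|T(t)u_0-T(t)u_{\mathrm{ref}}\|=+\infty$. The semigroup is chaotic relative to $u_{\mathrm{ref}}$ if the set of $u_0\in X$ whose trajectory is relatively chaotic with respect to $u_{\mathrm{ref}}$ is dense in $X$. The semigroup is Devaney chaotic (norm topology) if some orbit $\{T(t)x: t\ge 0\}$ is dense in $X$ and the set of periodic points $\{x\in X: \exists\, t_0>0,\ T(t_0)x=x\}$ is dense in $X$. *)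

(* Defs.v *)
From HB Require Import structures.
From mathcomp Require Import all_boot all_order all_algebra.
From mathcomp Require Import all_classical all_reals all_analysis.
Set Implicit Arguments.
Unset Strict Implicit.
Unset Printing Implicit Defensive.
Import Order.TTheory GRing.Theory Num.Theory.
Import numFieldNormedType.Exports.
Local Open Scope classical_set_scope.
Local Open Scope ring_scope.

Definition separable_space (X : topologicalType) : Prop :=
  exists2 D : set X, countable D & dense D.

Section semigroup.
Context {R : realType} {X : completeNormedModType R}.

(* A one-parameter family [(T t)_{t >= 0}] is encoded as a function on the
   whole of [R]; no definition below depends on the values [T t] for [t < 0]. *)
Implicit Types (T : R -> X -> X) (u : X).

Record C0_semigroup T : Prop := {
  C0_linear : forall t : R, 0 <= t -> linear (T t);
  C0_continuous : forall t : R, 0 <= t -> continuous (T t);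
  C0_id : forall x, T 0 x = x;
  C0_add : forall s t : R, 0 <= s -> 0 <= t -> forall x, T (s + t) x = T s (T t x);
  C0_strongly_continuous : forall x, T t x @[t --> 0^'+] --> x
}.

Definition reference_trajectory T u : Prop := forall t : R, 0 <= t -> T t u = u.

Definition relatively_chaotic_trajectory T uref u : Prop :=
  limf_einf (fun t : R => `|T t u - T t uref|%:E) +oo = 0%E /\
  limf_esup (fun t : R => `|T t u - T t uref|%:E) +oo = +oo%E.

Definition relatively_chaotic T uref : Prop :=
  dense [set u | relatively_chaotic_trajectory T uref u].

Definition trajectory T x : set X := [set T t x | t in [set t : R | 0 <= t]].

Definition periodic_points T : set X :=
  [set x | exists2 t : R, 0 < t & T t x = x].

Definition Devaney_chaotic T : Prop :=
  (exists x, dense (trajectory T x)) /\ dense (periodic_points T).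

End semigroup.

(* Main.v *)
(* On the space of real null sequences, grouped into two-dimensional blocks
   (u_(2k), u_(2k+1)), let the semigroup act on the k-th block by
   exp(-a_k t) [[1, t], [0, 1]] with a_k = scale k ^- 2. Every block orbit tends
   to 0, so 0 is the only periodic point, but the second basis vector of the
   k-th block first reaches norm about 1 / a_k. As the a_k decrease very fast,
   the vector with entry 1 / scale k at each 2k+1 has an orbit which is large at
   the times scale k ^+ 2 and small at the times scale k ^+ 6. Adding a small
   multiple of it to finitely supported sequences, whose orbits tend to 0, gives
   a dense set of relatively chaotic trajectories. *)
Require Import Defs.
From HB Require Import structures.
From mathcomp Require Import all_boot all_order all_algebra.
From mathcomp Require Import all_classical all_reals all_analysis.
From mathcomp Require Import ring lra zify.
Set Implicit Arguments.
Unset Strict Implicit.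
Unset Printing Implicit Defensive.
Import Order.TTheory GRing.Theory Num.Theory.
Import numFieldNormedType.Exports.
Local Open Scope classical_set_scope.
Local Open Scope ring_scope.

(** * The Banach space of real null sequences and its separability *)

Section null_sequences.
Context {R : realType}.
Implicit Types u v : nat -> R^o.

Definition null_sequence : {pred nat -> R^o} :=
  fun u => `[< u n @[n --> \oo] --> (0 : R^o) >].

Lemma null_sequenceP u : reflect (u n @[n --> \oo] --> (0 : R^o)) (u \in null_sequence).
Proof. exact: asboolP. Qed.

Lemma null_sequence_submod_closed : submod_closed null_sequence.
Proof.
split; first by apply/null_sequenceP; exact: cvg_cst.
move=> a u v /null_sequenceP u0 /null_sequenceP v0; apply/null_sequenceP.
rewrite -[X in _ --> X]addr0 -[X in _ --> X + _](scaler0 _ a).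
by apply: cvgD => //; exact: cvgZr.
Qed.

HB.instance Definition _ := GRing.isSubmodClosed.Build _ _ null_sequence
  null_sequence_submod_closed.

Record c0 := C0seq {c0_seq :> nat -> R^o; c0_null : c0_seq \in null_sequence}.

HB.instance Definition _ := [isSub for c0_seq].
HB.instance Definition _ := [Choice of c0 by <:].
HB.instance Definition _ := [SubChoice_isSubLmodule of c0 by <:].

Implicit Types x y : c0.

Lemma c0P x y : (forall n, x n = y n) -> x = y.
Proof. by move=> xy; apply/val_inj/funext. Qed.

Lemma c0D x y n : (x + y) n = x n + y n. Proof. by []. Qed.
Lemma c0B x y n : (x - y) n = x n - y n. Proof. by []. Qed.
Lemma c0Z a x n : (a *: x) n = a * x n. Proof. by []. Qed.
Lemma c00 n : (0 : c0) n = 0. Proof. by []. Qed.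

Lemma c0_cvg x : x n @[n --> \oo] --> (0 : R^o).
Proof. exact/null_sequenceP/c0_null. Qed.

Definition sup_norm x : R := sup (range (fun n => `|x n|)).

(** Convergent sequences are bounded, so the [sup] in [sup_norm] is a genuine supremum and not a
    default value. *)
Lemma has_sup_norm x : has_sup (range (fun n => `|x n|)).
Proof.
split; first by exists `|x 0%N|; exists 0%N.
have /cvg_seq_bounded[M [_ Mx]] : cvgn x by apply/cvg_ex; exists 0; exact: c0_cvg.
(* Boundedness is available only for constants strictly above [M], hence [M + 1]. *)
exists (M + 1) => _ [n _ <-].
by apply: (Mx (M + 1)) => //; rewrite ltrDl.
Qed.

Lemma le_sup_norm x n : `|x n| <= sup_norm x.
Proof. by apply: sup_upper_bound; [exact: has_sup_norm|exists n]. Qed.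

Lemma sup_norm_le x e : (forall n, `|x n| <= e) -> sup_norm x <= e.
Proof.
move=> xe; apply: ge_sup; first by case: (has_sup_norm x).
by move=> _ [n _ <-].
Qed.

Lemma sup_normD x y : sup_norm (x + y) <= sup_norm x + sup_norm y.
Proof.
apply: sup_norm_le => n; rewrite c0D (le_trans (ler_normD _ _))//.
by rewrite lerD// le_sup_norm.
Qed.

Lemma sup_normZ a x : sup_norm (a *: x) = `|a| * sup_norm x.
Proof.
have le b y : sup_norm (b *: y) <= `|b| * sup_norm y.
  by apply: sup_norm_le => n; rewrite c0Z normrM ler_wpM2l// le_sup_norm.
apply/eqP; rewrite eq_le le/=; have [->|a0] := eqVneq a 0.
  by rewrite normr0 mul0r (le_trans (normr_ge0 _) (le_sup_norm _ 0%N)).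
(* The reverse inequality is [le] applied to the scalar [a^-1] and the vector [a *: x]. *)
rewrite mulrC -ler_pdivlMr ?normr_gt0// mulrC -normfV.
by rewrite -{1}(scalerK a0 x) le.
Qed.

Lemma sup_norm_eq0 x : sup_norm x = 0 -> x = 0.
Proof.
move=> x0; apply/c0P => n; apply/eqP; rewrite -normr_le0 -x0.
exact: le_sup_norm.
Qed.

HB.instance Definition _ := Lmodule_isNormed.Build R c0 sup_normD sup_normZ sup_norm_eq0.

Lemma c0_norm_le x e : (forall n, `|x n| <= e) -> `|x| <= e.
Proof. exact: sup_norm_le. Qed.

Lemma le_c0_norm x n : `|x n| <= `|x|.
Proof. exact: le_sup_norm. Qed.

(** The limit is taken coordinatewise in the complete real line. The balls given by the Cauchy
    property yield an estimate uniform in the coordinate, which makes the limit a null sequence and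
    the convergence one in norm. *)
Lemma c0_complete (F : set_system c0) : ProperFilter F -> cauchy F -> cvg F.
Proof.
move=> FF /cauchyP F_cauchy.
pose l n : R^o := lim ((fun w : c0 => w n) @ F).
have xl e : 0 < e -> exists2 x, F (ball x e) & forall n, `|x n - l n| <= e.
  move=> e0; have [x Fx] := F_cauchy e e0; exists x => // n.
  have cvl : (fun w : c0 => w n) @ F --> l n.
    apply: cauchy_cvg; apply: cauchy_exP => d d0.
    have [z Fz] := F_cauchy d d0; exists (z n).
    suff : F [set w : c0 | ball (z n : R^o) d (w n)] by [].
    apply: filterS Fz => w; rewrite -!ball_normE /= => zw; apply: le_lt_trans zw.
    exact: (le_c0_norm (z - w)).
  (* The bound on [x n - w n] holds for all [w] in the ball, and a closed condition passes to the
     limit [l n]. *)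
  suff : closed [set r : R^o | `|x n - r| <= e].
    move=> /(@closed_cvg _ _ F FF (fun w : c0 => w n)); apply; last exact: cvl.
    apply: filterS Fx => w; rewrite -!ball_normE /= => /ltW xw; apply: le_trans xw.
    exact: (le_c0_norm (x - w)).
  have -> : [set r : R^o | `|x n - r| <= e] = closed_ball_ Num.norm (x n) e by [].
  exact: closed_closed_ball_.
have l0 : l \in null_sequence.
  apply/null_sequenceP/cvgr0Pnorm_lt => e e0.
  have e2 : 0 < e / 2 by rewrite divr_gt0.
  have [x _ xle] := xl _ e2; have /cvgr0Pnorm_lt/(_ _ e2) := c0_cvg x.
  apply: filterS => n xn; have := xle n.
  have : `|l n| <= `|x n| + `|x n - l n|.
    by rewrite -{1}[l n](subKr (x n)) ler_normB.
  lra.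
apply/cvg_ex; exists (C0seq l0); apply/cvgrPdist_le => e e0.
have [|x Fx xle] := xl (e / 2); first by rewrite divr_gt0.
apply: filterS Fx => w; rewrite -ball_normE /= => xw.
apply: c0_norm_le => n; have := xle n; have := le_c0_norm (x - w) n.
rewrite !c0B /= => ? ?.
have := ler_distD (x n) (l n) (w n); rewrite [`|l n - x n|]distrC; lra.
Qed.

HB.instance Definition _ := Uniform_isComplete.Build c0 c0_complete.

Definition trunc_seq N u : nat -> R^o := fun n => if (n < N)%N then u n else 0.

Lemma trunc_seq_null N u : trunc_seq N u \in null_sequence.
Proof.
apply/null_sequenceP; apply: cvg_near_cst; exists N => // n /= Nn.
by rewrite /trunc_seq ltnNge Nn.
Qed.

Definition trunc N u : c0 := C0seq (trunc_seq_null N u).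

Lemma truncE N u n : trunc N u n = if (n < N)%N then u n else 0.
Proof. by []. Qed.

Lemma trunc_approx x e : 0 < e -> exists N, `|x - trunc N x| <= e.
Proof.
move=> e0; have /cvgr0Pnorm_lt/(_ _ e0)[N _ xN] := c0_cvg x.
exists N; apply: c0_norm_le => n; rewrite c0B truncE.
case: ltnP => [_|/xN/ltW]; last by rewrite subr0.
by rewrite subrr normr0 ltW.
Qed.

(** The countable dense set consists of the finitely supported rational sequences: truncating costs
    e / 3, rounding the remaining entries another e / 3. *)
Lemma c0_separable : separable_space c0.
Proof.
pose D (s : seq rat) : c0 := trunc (size s) (fun n => ratr s`_n).
exists (range D); first exact: sub_countable (card_image_le _ _) (countableP _).
move=> O [x Ox] Oo.
have /nbhs_ballP[e /= e0 xeO] : nbhs x O by exact: open_nbhs_nbhs.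
have [|N xN] := @trunc_approx x (e / 3); first by rewrite divr_gt0.
have [q xq] : {q : nat -> rat & forall n, `|x n - ratr (q n)| <= e / 3}.
  apply: (@choice _ _ (fun n q => `|x n - ratr q| <= e / 3)) => n.
  have [|q] := @rat_in_itvoo R (x n - e / 3) (x n + e / 3).
    by rewrite ltrD2l; move: e0; lra.
  by rewrite in_itv /= => ?; exists q; rewrite ler_norml; lra.
exists (D (mkseq q N)); split; last by exists (mkseq q N).
apply: xeO; rewrite -ball_normE /=.
suff : `|x - D (mkseq q N)| <= e / 3 by lra.
apply: c0_norm_le => n; have := le_c0_norm (x - trunc N x) n.
rewrite !c0B !truncE size_mkseq; case: ltnP => [nN _|_]; last lra.
by rewrite nth_mkseq.
Qed.

End null_sequences.
Arguments c0 : clear implicits.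

(** * Lower and upper limits at infinity, and an exponential bound *)

Section limits_at_infinity.
Context {R : realType}.
Implicit Types f : R -> R.

Lemma limf_einf_pinfty_eq0 f : (forall t, 0 <= f t) ->
  (forall A e, 0 < e -> exists2 t, A < t & f t <= e) ->
  limf_einf (fun t => (f t)%:E) +oo = 0%E.
Proof.
move=> f0 fe; rewrite limf_einfE; apply/eqP; rewrite eq_le; apply/andP; split.
  apply: ge_ereal_sup => _ [V [A [_ AV]] <-].
  apply/lee_addgt0Pr => e /(fe A)[t At fte]; rewrite add0e.
  apply: (@le_trans _ _ (f t)%:E); last by rewrite lee_fin.
  by apply: ereal_inf_lbound; exists t => //; exact: AV.
(* For the lower bound the whole line serves as neighbourhood of infinity, since [f] is nonnegative
   everywhere. *)
apply: le_ereal_sup_tmp; exists (ereal_inf [set (f t)%:E | t in setT]).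
  by exists setT => //; exact: filterT.
by apply: le_ereal_inf_tmp => _ [t _ <-]; rewrite lee_fin.
Qed.

Lemma limf_esup_pinfty_eqy f :
  (forall A C, exists2 t, A < t & C <= f t) ->
  limf_esup (fun t => (f t)%:E) +oo = +oo%E.
Proof.
move=> fC; rewrite limf_esupE; apply/eqP; rewrite -leye_eq.
apply: le_ereal_inf_tmp => _ [V [A [_ AV]] <-].
rewrite leye_eq; apply/eqP/eqyP => C _; have [t At Ct] := fC A C.
apply: le_ereal_sup_tmp; exists (f t)%:E; last by rewrite lee_fin.
by exists t => //; exact: AV.
Qed.

(** The quadratic term of the exponential series alone gives this bound. The power 2 suffices
    because it beats the linear growth in t of the blocks. *)
Lemma expRN_le (y : R) : 0 < y -> expR (- y) <= 2 / y ^+ 2.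
Proof.
move=> y0; have := @expR_ge1Dxn R y 1 (ltW y0); rewrite expRN.
rewrite -[X in _ / X%:R]/2%N => ?; rewrite -invf_div lef_pV2 ?posrE ?expR_gt0//.
  by lra.
by rewrite divr_gt0// exprn_gt0.
Qed.

End limits_at_infinity.

(** * Scales, decay rates and the semigroup of Jordan blocks *)

Section block_semigroup.
Context {R : realType}.
Implicit Types (s t : R) (u : nat -> R^o) (x y : c0 R).

(* The k-th block decays at rate [scale k ^- 2]; the exponent 8 makes
   [scale k ^+ 6], at which block k has died out, still negligible with respect
   to [scale k.+1]. *)
Definition scale (k : nat) : R := 2 ^+ (8 ^ k).

Lemma scaleS k : scale k.+1 = scale k ^+ 8.
Proof. by rewrite /scale expnSr exprM. Qed.

Lemma scale_ge k : k.+1%:R <= scale k.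
Proof.
rewrite /scale -natrX ler_nat; apply: ltn_trans (ltn_expl _ _) => //.
exact: ltn_expl.
Qed.

Lemma scale_ge1 k : 1 <= scale k.
Proof. by apply: exprn_ege1; rewrite ler1n. Qed.

Lemma scale_gt0 k : 0 < scale k.
Proof. exact: lt_le_trans (scale_ge1 k). Qed.

Lemma scale_le j k : (j <= k)%N -> scale j <= scale k.
Proof. by move=> jk; rewrite ler_weXn2l ?ler1n// leq_pexp2l. Qed.

Lemma scale_unbounded C : exists k, C <= scale k.
Proof.
exists (Num.bound `|C|); apply: le_trans (scale_ge _); apply: ltW.
apply: le_lt_trans (ler_norm C) (lt_trans (archi_boundP (normr_ge0 C)) _).
by rewrite ltr_nat.
Qed.

Definition rate k : R := (scale k ^+ 2)^-1.

Lemma rate_gt0 k : 0 < rate k.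
Proof. by rewrite invr_gt0 exprn_gt0// scale_gt0. Qed.

Lemma rate_le1 k : rate k <= 1.
Proof. by rewrite invf_le1 ?exprn_gt0 ?scale_gt0// exprn_ege1// scale_ge1. Qed.

Lemma rate_le j k : (j <= k)%N -> rate k <= rate j.
Proof.
move=> jk; rewrite lef_pV2 ?posrE ?exprn_gt0 ?scale_gt0//.
by rewrite ler_pXn2r ?nnegrE ?(ltW (scale_gt0 _))// scale_le.
Qed.

Definition decay k t : R := expR (- (rate k * t)).

Lemma decay_gt0 k t : 0 < decay k t. Proof. exact: expR_gt0. Qed.

Lemma decayD k s t : decay k (s + t) = decay k s * decay k t.
Proof. by rewrite /decay mulrDr opprD expRD. Qed.

Lemma decay0 k : decay k 0 = 1.
Proof. by rewrite /decay mulr0 oppr0 expR0. Qed.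

Lemma decay_lt1 k t : 0 < t -> decay k t < 1.
Proof. by move=> t0; rewrite expR_lt1 oppr_lt0 mulr_gt0// rate_gt0. Qed.

Lemma decay_le1 k t : 0 <= t -> decay k t <= 1.
Proof. by move=> t0; rewrite expR_le1 oppr_le0 mulr_ge0// ltW// rate_gt0. Qed.

Lemma decay_ge k t : 0 <= t -> 1 - t <= decay k t.
Proof.
move=> t0; apply: le_trans (expR_ge1Dx _); rewrite lerD2l lerN2.
by rewrite ler_piMl// rate_le1.
Qed.

(** This bound is uniform in [k] and covers negative times too, as [block t] is constructed for
    every real [t]. *)
Lemma decay_le k t : decay k t <= expR `|t|.
Proof.
rewrite ler_expR (le_trans (ler_norm _))// normrN normrM.
by rewrite ler_piMl// gtr0_norm ?rate_gt0// rate_le1.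
Qed.

(** Block [k] decays slowest among the blocks up to [k], so it is enough to apply [expRN_le] to
    [rate k * t]. *)
Lemma decay_small j k t : (j <= k)%N -> 0 < t ->
  decay j t <= 2 * scale k ^+ 4 / t ^+ 2.
Proof.
move=> jk t0; have rt0 : 0 < rate k * t by rewrite mulr_gt0// rate_gt0.
apply: (@le_trans _ _ (decay k t)).
  by rewrite ler_expR lerN2 ler_wpM2r// ?rate_le// ltW.
apply: le_trans (expRN_le rt0) _; rewrite /rate le_eqVlt; apply/orP; left.
have := lt0r_neq0 (scale_gt0 k); have := lt0r_neq0 t0 => t0' s0'.
by apply/eqP; field; rewrite t0' s0'.
Qed.

(** On block k this is the exponential of t times the Jordan block [[- a_k, 1], [0, - a_k]]: odd
    coordinates are only damped, even ones also receive t times their successor. *)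
Definition block_seq t u : nat -> R^o :=
  fun n => decay n./2 t * (u n + if odd n then 0 else t * u n.+1).

Lemma block_seq_le t u n :
  `|block_seq t u n| <= decay n./2 t * (`|u n| + `|t| * `|u n.+1|).
Proof.
rewrite normrM (gtr0_norm (decay_gt0 _ _)) ler_wpM2l ?(ltW (decay_gt0 _ _))//.
rewrite (le_trans (ler_normD _ _))// lerD2l.
by case: odd; rewrite ?normr0 ?mulr_ge0// normrM.
Qed.

Lemma block_seq_null t x : block_seq t x \in null_sequence.
Proof.
pose C := expR `|t| * (1 + `|t|).
have C0 : 0 < C by rewrite mulr_gt0 ?expR_gt0// ltr_pwDl.
apply/null_sequenceP/cvgr0Pnorm_lt => e e0.
have /cvgr0Pnorm_lt/(_ _ (divr_gt0 e0 C0))[N _ xN] := c0_cvg x.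
exists N => // n /= Nn; apply: le_lt_trans (block_seq_le t x n) _.
have xn := xN n Nn; have xn1 := xN n.+1 (leqW Nn).
apply: (@le_lt_trans _ _ (expR `|t| * (`|x n| + `|t| * `|x n.+1|))).
  by rewrite ler_wpM2r ?decay_le// addr_ge0// mulr_ge0.
have -> : e = expR `|t| * (e / C + `|t| * (e / C)).
  have := lt0r_neq0 C0; rewrite /C mulf_eq0 negb_or => /andP[p q].
  by field; rewrite p q.
rewrite ltr_pM2l ?expR_gt0// ltr_leD// ler_wpM2l//.
exact: ltW.
Qed.

Definition block t x : c0 R := C0seq (block_seq_null t x).

Lemma blockE t x n :
  block t x n = decay n./2 t * (x n + if odd n then 0 else t * x n.+1).
Proof. by []. Qed.

Lemma block_le t x n : `|block t x n| <= decay n./2 t * ((1 + `|t|) * `|x|).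
Proof.
apply: le_trans (block_seq_le t x n) _.
rewrite ler_wpM2l ?(ltW (decay_gt0 _ _))// mulrDl mul1r.
by rewrite lerD ?ler_wpM2l// le_c0_norm.
Qed.

Lemma block_linear t : linear (block t).
Proof.
move=> a x y; apply/c0P => n; rewrite blockE !c0D !c0Z !blockE.
by case: odd; rewrite ?c0D ?c0Z; ring.
Qed.

Lemma blockD t x y : block t (x + y) = block t x + block t y.
Proof. by have := block_linear t 1 x y; rewrite !scale1r. Qed.

Lemma blockZ t a x : block t (a *: x) = a *: block t x.
Proof.
apply/c0P => n; rewrite blockE !c0Z blockE.
by case: odd; rewrite ?c0Z; ring.
Qed.

Lemma blockB t x y : block t (x - y) = block t x - block t y.
Proof. by rewrite blockD -scaleN1r blockZ scaleN1r. Qed.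

Lemma block_continuous t : continuous (block t).
Proof.
move=> x; pose C := expR `|t| * (1 + `|t|).
have C0 : 0 < C by rewrite mulr_gt0 ?expR_gt0// ltr_pwDl.
have lip z : `|block t z| <= C * `|z|.
  apply: c0_norm_le => n; apply: le_trans (block_le t z n) _.
  by rewrite -mulrA ler_wpM2r ?decay_le// mulr_ge0// addr_ge0.
apply/(@cvgrPdist_le _ _ _ _ (nbhs_filter x)) => e e0.
apply/nbhs_ballP; exists (e / C) => /=; first by rewrite divr_gt0.
move=> z; rewrite -ball_normE /= => xz.
by rewrite -blockB; apply: le_trans (lip _) _; rewrite mulrC -ler_pdivlMr// ltW.
Qed.

Lemma block_id x : block 0 x = x.
Proof.
by apply/c0P => n; rewrite blockE decay0 mul1r mul0r if_same addr0.
Qed.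

Lemma block_add s t x : block (s + t) x = block s (block t x).
Proof.
apply/c0P => n; rewrite !blockE decayD.
case: ifPn => odd_n; first by ring.
(* For even [n] the successor lies in the same block, so it carries the same decay factor. *)
have -> : n.+1./2 = n./2 by rewrite /= uphalf_half (negbTE odd_n).
by rewrite /= odd_n; ring.
Qed.

(** Since all rates are at most 1, the loss by damping and the off-diagonal term each contribute at
    most [t] times the norm. *)
Lemma block_dist_le t x : 0 <= t -> `|x - block t x| <= 2 * t * `|x|.
Proof.
move=> t0; apply: c0_norm_le => n; rewrite c0B blockE.
have d0 := decay_gt0 n./2 t; have d1 := decay_le1 n./2 t0.
have dt := decay_ge n./2 t0; set d := decay _ _ in d0 d1 dt *.
set z := if _ then _ else _.
have z_le : `|z| <= t * `|x|.
  rewrite /z; case: odd; first by rewrite normr0 mulr_ge0.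
  by rewrite normrM ger0_norm// ler_wpM2l// le_c0_norm.
have -> : x n - d * (x n + z) = (1 - d) * x n - d * z by ring.
rewrite (le_trans (ler_normB _ _))// !normrM (gtr0_norm d0) ger0_norm ?subr_ge0//.
have -> : 2 * t * `|x| = t * `|x| + t * `|x| by ring.
apply: lerD.
  by apply: ler_pM; rewrite ?subr_ge0 ?le_c0_norm//; lra.
by apply: le_trans z_le; rewrite ler_piMl.
Qed.

Lemma block_C0_semigroup : C0_semigroup block.
Proof.
split=> [t _|t _|x|s t _ _ x|x].
- exact: block_linear.
- exact: block_continuous.
- exact: block_id.
- exact: block_add.
apply/cvgrPdist_le => e e0.
(* Adding 1 keeps the divisor positive when [x] is 0. *)
have C0 : 0 < 2 * (`|x| + 1) by rewrite mulr_gt0// ltr_wpDl.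
near=> t; have t0 : 0 < t by near: t; exact: nbhs_right_gt.
apply: le_trans (block_dist_le x (ltW t0)) _.
have : t <= e / (2 * (`|x| + 1)).
  by near: t; apply: nbhs_right_le; rewrite divr_gt0.
rewrite ler_pdivlMr//; have := normr_ge0 x; nra.
Unshelve. all: by end_near. Qed.

(** At a positive period an odd coordinate is multiplied by a factor below 1, hence vanishes. The
    even coordinates are then only damped and vanish as well. *)
Lemma block_periodic_points : periodic_points block `<=` [set 0].
Proof.
move=> x [t t0 xt].
have fix0 k (r : R) : r = decay k t * r -> r = 0.
  move=> /eqP; rewrite -subr_eq0 -{1}[r]mul1r -mulrBl mulf_eq0 subr_eq0.
  by rewrite gt_eqF ?decay_lt1//= => /eqP.
have xE n : x n = decay n./2 t * (x n + if odd n then 0 else t * x n.+1).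
  by rewrite -blockE xt.
have x_odd n : odd n -> x n = 0.
  by move=> on; apply: (fix0 n./2); have := xE n; rewrite on addr0.
apply/c0P => n; rewrite c00; have [/x_odd//|en] := boolP (odd n).
apply: (fix0 n./2); have := xE n.
by rewrite (negbTE en) (x_odd n.+1) ?mulr0 ?addr0.
Qed.

(** Finitely many blocks are involved, so the decay of order 1 / t ^ 2 from [decay_small] outweighs
    the growth [1 + t <= 2 * t]. *)
Lemma block_trunc_le t N u : 1 <= t ->
  `|block t (trunc N u)| <= 4 * scale N ^+ 4 * `|trunc N u| / t.
Proof.
move=> t1; have t0 : 0 < t by exact: lt_le_trans t1.
apply: c0_norm_le => n; have [nN|Nn] := ltnP n N; last first.
  rewrite blockE !truncE ltnNge Nn/= ltnNge (leqW Nn)/= mulr0 if_same addr0.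
  rewrite mulr0 normr0 divr_ge0 ?(ltW t0)// mulr_ge0// mulr_ge0//.
  exact: exprn_ge0 (ltW (scale_gt0 _)).
apply: le_trans (block_le t (trunc N u) n) _.
apply: (@le_trans _ _ (2 * scale N ^+ 4 / t ^+ 2 * (2 * t * `|trunc N u|))).
  apply: ler_pM; rewrite ?(ltW (decay_gt0 _ _)) ?mulr_ge0 ?addr_ge0//.
    by apply: decay_small => //; lia.
  by rewrite ler_wpM2r// gtr0_norm//; lra.
by rewrite le_eqVlt; apply/orP; left; apply/eqP; field; rewrite lt0r_neq0.
Qed.

(** * The spike vector and the relatively chaotic trajectories *)

Definition spike_seq : nat -> R^o :=
  fun n => if odd n then (scale n./2)^-1 else 0.

Lemma spike_seq_null : spike_seq \in null_sequence.
Proof.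
apply/null_sequenceP/cvgr0Pnorm_lt => e e0.
exists (Num.bound e^-1).*2 => // n /= en; rewrite /spike_seq.
case: odd; last by rewrite normr0.
rewrite gtr0_norm ?invr_gt0 ?scale_gt0// invf_plt ?posrE ?scale_gt0//.
apply: lt_le_trans (scale_ge _).
have /lt_le_trans : e^-1 < (Num.bound e^-1)%:R by rewrite archi_boundP// invr_ge0 ltW.
by apply; rewrite ler_nat; lia.
Qed.

Definition spike : c0 R := C0seq spike_seq_null.

Lemma spike_neq0 : spike != 0.
Proof.
apply/eqP => /(congr1 (fun x : c0 R => x 1%N)); rewrite c00 /=.
by move/eqP; rewrite invr_eq0 gt_eqF// scale_gt0.
Qed.

(** The time is [1 / rate k], so block [k] has decayed only by [expR (- 1)], while its even
    coordinate has grown to [scale k ^+ 2 / scale k]. *)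
Lemma block_spike_large k :
  expR (- 1) * scale k <= `|block (scale k ^+ 2) spike|.
Proof.
apply: le_trans (le_c0_norm _ k.*2); rewrite blockE odd_double doubleK /=.
rewrite /spike_seq /= odd_double /= uphalf_double /decay mulVf; last first.
  by rewrite expf_neq0// gt_eqF// scale_gt0.
by rewrite add0r expr2 mulfK ?ler_norm// gt_eqF// scale_gt0.
Qed.

Lemma block_spike_small k :
  `|block (scale k ^+ 6) spike| <= 2 / scale k ^+ 2.
Proof.
have sk0 := scale_gt0 k; have sk1 := scale_ge1 k.
set t := scale k ^+ 6; have t1 : 1 <= t by rewrite exprn_ege1.
have t0 : 0 < t by exact: lt_le_trans t1.
apply: c0_norm_le => n.
have sj0 := scale_gt0 n./2; have sj1 := scale_ge1 n./2.
(* As [t >= 1], the same bound serves both parities. *)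
have : `|block t spike n| <= decay n./2 t * (t / scale n./2).
  rewrite blockE normrM (gtr0_norm (decay_gt0 _ _)).
  rewrite ler_wpM2l ?(ltW (decay_gt0 _ _))//= /spike_seq.
  have [on|en] := boolP (odd n); rewrite /= ?(negbTE en) ?on ?en.
    by rewrite addr0 gtr0_norm ?invr_gt0// ler_peMl// invr_ge0 ltW.
  have -> : uphalf n = n./2 by rewrite uphalf_half (negbTE en).
  by rewrite add0r gtr0_norm// divr_gt0.
move=> /le_trans; apply; have [jk|kj] := leqP n./2 k.
  (* Blocks up to [k] have died out: with [t = scale k ^+ 6], the product is
     [2 * scale k ^+ 4 / t = 2 / scale k ^+ 2]. *)
  apply: (@le_trans _ _ (2 * scale k ^+ 4 / t ^+ 2 * t)).
    apply: ler_pM; rewrite ?(ltW (decay_gt0 _ _)) ?divr_ge0 ?(ltW t0) ?(ltW sj0)//.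
      exact: decay_small.
    by rewrite ler_pdivrMr// ler_peMr// ltW.
  rewrite le_eqVlt; apply/orP; left; apply/eqP; rewrite /t; field.
  by rewrite lt0r_neq0.
(* Later blocks have not grown yet: their entries are at most [1 / scale k ^+ 8], so even without
   decay they reach at most [t / scale k ^+ 8]. *)
have := scale_le kj; rewrite scaleS => sj.
apply: (@le_trans _ _ (1 * (t / scale k ^+ 8))).
  apply: ler_pM; rewrite ?(ltW (decay_gt0 _ _)) ?divr_ge0 ?(ltW t0) ?(ltW sj0)//.
    by rewrite decay_le1// ltW.
  by rewrite ler_wpM2l ?(ltW t0)// lef_pV2// posrE exprn_gt0.
rewrite mul1r /t -[X in _ / _ ^+ X]/(6 + 2)%N exprD invfM mulrA mulfV ?mul1r.
  by rewrite ler_peMl ?ler1n// invr_ge0 exprn_ge0// ltW.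
by rewrite expf_neq0// gt_eqF.
Qed.

Lemma block0 t : block t 0 = 0.
Proof. by rewrite -[X in block _ X](scale0r 0) blockZ scale0r. Qed.

(** The truncated part is at most [K / t] and tends to 0, so the spike decides both limits, along
    the times [scale k ^+ 6] and [scale k ^+ 2]. *)
Lemma irregular N u d : 0 < d ->
  relatively_chaotic_trajectory block 0 (trunc N u + d *: spike).
Proof.
move=> d0; rewrite /relatively_chaotic_trajectory.
under eq_fun do rewrite block0 subr0 blockD blockZ.
set K := 4 * scale N ^+ 4 * `|trunc N u|.
have K0 : 0 <= K.
  by rewrite mulr_ge0// mulr_ge0// exprn_ge0// ltW// scale_gt0.
have f_le t : 1 <= t -> `|block t (trunc N u)| <= K / t by exact: block_trunc_le.
split.
  apply: limf_einf_pinfty_eq0 => [//|A e e0].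
  (* The first bound puts the time beyond [A]; the second makes [(K + d * 2) / scale k], which
     bounds the norm, at most [e]. *)
  have [k] := scale_unbounded (Num.max (A + 1) ((K + d * 2) / e)).
  rewrite ge_max => /andP[Ak ek]; have sk1 := scale_ge1 k; have sk0 := scale_gt0 k.
  have s6 : scale k <= scale k ^+ 6 by rewrite ler_eXnr.
  have s2 : scale k <= scale k ^+ 2 by rewrite ler_eXnr.
  exists (scale k ^+ 6); first by lra.
  rewrite (le_trans (ler_normD _ _))// normrZ gtr0_norm//.
  apply: (@le_trans _ _ (K / scale k + d * (2 / scale k))).
    apply: lerD.
      apply: le_trans (f_le _ _) _; first by lra.
      by rewrite ler_wpM2l// lef_pV2// posrE//; lra.
    rewrite ler_pM2l//; apply: le_trans (block_spike_small _) _.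
    by rewrite ler_pM2l// lef_pV2 ?posrE ?exprn_gt0//.
  by rewrite mulrA -mulrDl ler_pdivrMr// [e * _]mulrC -ler_pdivrMr.
apply: limf_esup_pinfty_eqy => A C.
(* Here the spike term must exceed [C] by [K], the most that the truncated part can cancel. *)
have [k] := scale_unbounded (Num.max (A + 1) ((C + K) / (d * expR (- 1)))).
rewrite ge_max => /andP[Ak Ck]; have sk1 := scale_ge1 k.
have s2 : scale k <= scale k ^+ 2 by rewrite ler_eXnr.
exists (scale k ^+ 2); first by lra.
have t1 : 1 <= scale k ^+ 2 by lra.
have fK : `|block (scale k ^+ 2) (trunc N u)| <= K.
  by apply: le_trans (f_le _ t1) _; rewrite ler_pdivrMr ?ler_peMr//; lra.
have : C + K <= d * `|block (scale k ^+ 2) spike|.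
  apply: (@le_trans _ _ (d * (expR (- 1) * scale k))); last first.
    by rewrite ler_pM2l// block_spike_large.
  by rewrite mulrA mulrC -ler_pdivrMr// mulr_gt0// expR_gt0.
set f := block _ _; set g := block _ _ in fK *.
rewrite -{1}(gtr0_norm d0) -normrZ; have := lerB_normD (d *: f) g.
by rewrite [d *: f + g]addrC; lra.
Qed.

Lemma irregular_dense : relatively_chaotic block 0.
Proof.
move=> O [x Ox] Oo.
have /nbhs_ballP[e /= e0 xeO] : nbhs x O by exact: open_nbhs_nbhs.
have [|N xN] := @trunc_approx _ x (e / 3); first by rewrite divr_gt0.
have sp0 : 0 < `|@spike| by rewrite normr_gt0 spike_neq0.
(* With this [d] the added multiple of the spike has norm e / 3, so the total distance to [x] is at
   most 2 e / 3. *)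
pose d := e / 3 / `|spike|; have d0 : 0 < d by rewrite !divr_gt0.
exists (trunc N x + d *: spike); split; last exact: irregular.
apply: xeO; rewrite -ball_normE /= opprD addrA.
apply: le_lt_trans (ler_normB _ _) _; rewrite normrZ gtr0_norm//.
rewrite {1}/d divfK ?gt_eqF//; move: e0; lra.
Qed.

(** The periodic points are not dense: the open ball around [spike] of radius its own norm misses
    0. *)
Lemma block_not_Devaney : ~ Devaney_chaotic block.
Proof.
move=> [_ /(_ (ball spike `|spike|))].
have sp0 : 0 < `|@spike| by rewrite normr_gt0 spike_neq0.
move=> /(_ (ex_intro _ _ (ballxx _ sp0)) (ball_open _ _))[x []].
by move=> /[swap] /block_periodic_points ->; rewrite -ball_normE /= subr0 ltxx.
Qed.

End block_semigroup.

Theorem theorem5p13 (R : realType) :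
  exists (X : completeNormedModType R) (T : R -> X -> X) (uref : X),
    [/\ separable_space X, C0_semigroup T, reference_trajectory T uref,
        relatively_chaotic T uref & ~ Devaney_chaotic T].
Proof.
exists (c0 R), block, 0; split.
- exact: c0_separable.
- exact: block_C0_semigroup.
- by move=> t _; exact: block0.
- exact: irregular_dense.
- exact: block_not_Devaney.
Qed.
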